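(* Let $g\ge 4$ and $t\ge 0$ be integers, let $n=g+t(g-2)$, and let $F_n$ be a (simple) $2$-regular graph with $n$ vertices. Then $F_n$ is potentially $g$-angulable in $K_n$ if and only if $n\ge 5$.
   Context: $K_n$ denotes the convex complete graph on $n$ points in convex position in the plane, with straight-line edges. A $g$-angulation of the point set is a plane (non-crossing straight-line) graph on the $n$ points in which every face interior to the convex hull is bounded by a $g$-cycle (so it contains all edges of the convex hull boundary). A geometric graph $G$ on these points admits a $g$-angulation if some $g$-angulation has its edge set contained in $E(G)$. A graph $F$ with $n$ vertices is potentially $g$-angulable in $K_n$ if there is a placement of $F$ in $K_n$ (a bijection from $V(F)$ to the $n$ points, edges drawn as straight segments) such that $K_n-F$, obtained by deleting the edges of the placed copy of $F$ from $K_n$, admits a $g$-angulation. *)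

(* Defs.v *)
From mathcomp Require Import all_boot all_order all_algebra.
From mathcomp Require Import all_classical all_reals all_analysis.

Set Implicit Arguments.
Unset Strict Implicit.
Unset Printing Implicit Defensive.

Import Order.TTheory GRing.Theory Num.Theory.
Import numFieldNormedType.Exports.

Local Open Scope classical_set_scope.
Local Open Scope ring_scope.

Definition simple_graph (V : finType) (e : rel V) : Prop :=
  symmetric e /\ irreflexive e.

Definition regular_graph (V : finType) (d : nat) (e : rel V) : Prop :=
  forall u : V, #|[pred v | e u v]| = d.

Definition frontier (T : topologicalType) (A : set T) : set T :=
  closure A `\` interior A.

Section ConvexGeometricGraphs.
Context {R : realType}.

Definition segment (a b : R * R) : set (R * R) :=
  [set (1 - s) *: a + s *: b | s in `[0, 1]%classic].

Definition conv_hull (A : set (R * R)) : set (R * R) :=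
  smallest (@convex_set R (R * R)%type) A.

Context {n : nat}.
Implicit Types (p : 'I_n -> R * R) (T G : rel 'I_n).

(* This forces the points to be pairwise distinct, but their labels need not
   follow the cyclic order around the hull. *)
Definition convex_position p : Prop :=
  forall i, ~ conv_hull (p @` [set j | j != i]) (p i).

Definition drawing p T : set (R * R) :=
  [set x | exists i j, T i j /\ segment (p i) (p j) x].

Definition noncrossing p T : Prop :=
  forall i j k l, T i j -> T k l -> [set i; j]%SET != [set k; l]%SET ->
  forall x, segment (p i) (p j) x -> segment (p k) (p l) x ->
  exists2 m, (m \in [set i; j]%SET) && (m \in [set k; l]%SET) & x = p m.

Definition face p T (F : set (R * R)) : Prop :=
  exists2 x, ~ drawing p T x & F = connected_component (~` drawing p T) x.

(* A [g]-cycle is given by the cyclic sequence [c] of its vertices; this is the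
   right notion for [g >= 3]. *)
Definition bounded_by_cycle p T (g : nat) (F : set (R * R)) : Prop :=
  exists c : seq 'I_n, [/\ size c = g, uniq c, path.cycle T c &
    frontier F = [set x | exists2 i, i \in c & segment (p i) (p (next c i)) x]].

(* The hull edges are required explicitly because a plane graph that misses one
   could have no face inside the hull at all. *)
Definition g_angulation p (g : nat) T : Prop :=
  [/\ simple_graph T, noncrossing p T,
      (forall i j, i != j ->
         segment (p i) (p j) `<=` frontier (conv_hull (range p)) -> T i j) &
      (forall F, face p T F -> F `<=` conv_hull (range p) ->
         bounded_by_cycle p T g F)].

Definition admits_g_angulation p (g : nat) G : Prop :=
  exists2 T : rel 'I_n, g_angulation p g T & subrel T G.

Definition complete_minus (V : finType) (e : rel V) (f : V -> 'I_n) :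
    rel 'I_n :=
  fun i j => (i != j) &&
    ~~ [exists u, exists v, [&& e u v, f u == i & f v == j]].

Definition potentially_g_angulable p (g : nat) (V : finType) (e : rel V) :
    Prop :=
  exists2 f : V -> 'I_n, bijective f &
    admits_g_angulation p g (complete_minus e f).

End ConvexGeometricGraphs.

(* Main.v *)
Require Import Defs.
From mathcomp Require Import all_boot all_order all_algebra.
From mathcomp Require Import all_classical all_reals all_analysis.
From mathcomp Require Import zify ring lra.

(** Number the points q_0, ..., q_(n-1) counterclockwise, put d = g - 2, and take
    as angulation the fan with centre q_0: the sides of the hull together with
    the chords from q_0 to the positions congruent to 1 modulo d.  Since
    n = (t + 1) d + 2, the two hull sides at q_0 also lead to positions congruent
    to 1 modulo d, and the fan cuts the hull into t + 1 convex g-gons.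

    A copy of F avoids this fan when its vertices can be listed as a, l so that
    consecutive entries of l are not adjacent and the two neighbours of a stand
    at the positions 2 and n - 2, which are congruent to 2 and to 0 modulo d and
    so carry no chord of the fan (for d = 2 these residues agree, and both differ
    from 1).  This condition depends on n only.  Such a hub order exists for
    every 2-regular F with n >= 5 (hub_order_exists).  For n >= 10 a greedy choice
    places nine vertices, four of them strictly between the neighbours x and y
    of a; each further vertex is inserted between x and y, where there are at
    least five gaps and its two neighbours spoil at most four
    (insert_apart).  For 5 <= n <= 9 the 2-regular graphs are enumerated by
    computation (small_orders).

    The geometric part shows that the fan is a g-angulation (fan_angulation).
    Points in convex position are sorted by angle around a leftmost point
    (ccw_order), after which all incidences are signs of orientation
    determinants.  The open cell of a convex polygon is convex, hence
    connected, and its boundary is drawn, hence it is a whole component of the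
    complement of the drawing (component_open_polygon); every undrawn point of
    the hull lies in such a cell, found between two consecutive chords around
    q_0 by a change of sign (cell_cover).

    Conversely n < 5 forces n = g = 4, where F is a 4-cycle.  An angulation
    contains the two hull sides at a point, so the vertex of F placed there
    has only one possible neighbour left. *)

Set Implicit Arguments.
Unset Strict Implicit.
Unset Printing Implicit Defensive.

(** * Paths in the complement of a graph *)

(** The centre [a] of the fan takes position 0 and [l] the positions from 1 on, so
    the indices 1 and [size l - 2] in [l] are the positions 2 and n - 2. *)
Definition hub_order (T : eqType) (e : rel T) (a : T) (l : seq T) : bool :=
  sorted (fun u v => ~~ e u v) l &&
  all (fun k => e a (nth a l k) ==> (k == 1) || (k == size l - 2))
      (iota 0 (size l)).

Section Insertion.
Context (V : eqType) (e : rel V).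
Hypothesis e_sym : symmetric e.
Let apart u v := ~~ e u v.

(** A vertex [z] can enter a gap unless one of the two ends of the gap is [z1] or
    [z2]; each of these two spoils at most two gaps, and there are at least
    five. *)
Lemma insert_apart (x y z z1 z2 : V) (w : seq V) :
  (forall v, e z v -> v = z1 \/ v = z2) ->
  4 <= size w -> uniq (x :: rcons w y) -> path apart x (rcons w y) ->
  exists i, path apart x (rcons (take i w ++ z :: drop i w) y).
Proof.
move=> nbz w_ge4; rewrite cons_uniq => /andP[x_w uw] pw.
pose forbidden := [:: index z1 (x :: w); index z2 (x :: w);
                      index z1 (rcons w y); index z2 (rcons w y)].
have [i i_le iF] : exists2 i, i <= size w & i \notin forbidden.
  have /allPn[i] : ~~ all (mem forbidden) (iota 0 5).
    by apply/negP => /allP /(uniq_leq_size (iota_uniq 0 5)).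
  by rewrite mem_iota => /andP[_ i5] ?; exists i => //; lia.
have uxw : uniq (x :: w).
  rewrite /= (contra _ x_w); first by move: uw; rewrite rcons_uniq => /andP[].
  by rewrite mem_rcons inE => ->; rewrite orbT.
move: iF; rewrite !inE !negb_or => /and4P[i1 i2 i3 i4].
(* The gap [i] follows the entry [i] of [x :: w] and precedes the entry [i] of
   [rcons w y]. *)
have before : apart (last x (take i w)) z.
  have -> : last x (take i w) = nth x (x :: w) i.
    rewrite (last_nth x) size_takel //.
    by case: i i_le {i1 i2 i3 i4} => //= i i_lt; rewrite nth_take.
  rewrite /apart e_sym; apply/negP => /nbz[] ez.
    by move/eqP: i1; apply; rewrite -ez index_uniq.
  by move/eqP: i2; apply; rewrite -ez index_uniq.
have after : apart z (nth y (rcons w y) i).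
  have i_lt : i < size (rcons w y) by rewrite size_rcons.
  apply/negP => /nbz[] ez.
    by move/eqP: i3; apply; rewrite -ez index_uniq.
  by move/eqP: i4; apply; rewrite -ez index_uniq.
exists i; rewrite rcons_cat rcons_cons cat_path /= before /=.
have := pw; rewrite -{1}(cat_take_drop i w) rcons_cat cat_path.
case/andP=> -> /=.
case E: (rcons (drop i w) y) => [|b r] /=; first by case: (drop i w) E.
case/andP=> _ ->; rewrite andbT.
suff <- : nth y (rcons w y) i = b by [].
by rewrite -(cat_take_drop i w) rcons_cat nth_cat size_takel // ltnn subnn E.
Qed.

Lemma insert_all_apart (x y : V) (u w : seq V) :
  (forall v, exists v1 v2, forall v', e v v' -> v' = v1 \/ v' = v2) ->
  4 <= size w -> uniq (u ++ x :: rcons w y) -> path apart x (rcons w y) ->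
  exists2 w', perm_eq w' (u ++ w) & path apart x (rcons w' y).
Proof.
move=> nb; elim: u w => [|z u IHu] w w_ge4; first by exists w.
rewrite cat_cons cons_uniq => /andP[z_uw uuw] pw.
have [z1 [z2 nbz]] := nb z.
have uw : uniq (x :: rcons w y) by move: uuw; rewrite cat_uniq => /and3P[].
have [i pi] := insert_apart nbz w_ge4 uw pw.
set w1 := take i w ++ z :: drop i w in pi.
have w1w : perm_eq w1 (z :: w).
  by rewrite /w1 perm_catC /= perm_cons perm_catC cat_take_drop.
clearbody w1.
have [||w' w'P pw'] := IHu w1 _ _ pi; last first.
- exists w' => //; rewrite (perm_trans w'P) //; apply/permP => P.
  by rewrite !count_cat (permP w1w) /=; lia.
- have : perm_eq (u ++ x :: rcons w1 y) (z :: u ++ x :: rcons w y).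
    apply/permP => P; rewrite /= !count_cat /= -!cats1 !count_cat (permP w1w) /=.
    lia.
  by move=> /perm_uniq ->; rewrite cons_uniq z_uw.
- by rewrite (perm_size w1w) /= ltnW.
Qed.
End Insertion.

(** * Hub orders on at least ten vertices *)

Section TwoRegular.
Context (V : finType) (e : rel V).
Hypotheses (e_simple : simple_graph e) (e_regular : regular_graph 2 e).

Let e_sym : symmetric e. Proof. by case: e_simple. Qed.
Let e_irr : irreflexive e. Proof. by case: e_simple. Qed.

Lemma other_neighbour (u x : V) : e u x ->
  exists2 y, y != x & forall v, e u v = (v == x) || (v == y).
Proof.
move=> ux; have := e_regular u; rewrite (cardD1 x) inE ux => -[].
move=> /mem_card1[y yP]; exists y; first by have := yP y; rewrite !inE eqxx => /andP[].
move=> v; have := yP v; rewrite !inE; case: eqVneq => [->|_ /= ->] //.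
Qed.

Lemma two_neighbours (u : V) :
  exists x y, y != x /\ forall v, e u v = (v == x) || (v == y).
Proof.
have /card_gt0P[x ux] : 0 < #|[pred v | e u v]| by rewrite e_regular.
by have [y yx nb] := other_neighbour ux; exists x, y.
Qed.

Lemma outside (l : seq V) : size l < #|V| -> exists v, v \notin l.
Proof.
move=> l_lt; apply/existsP; apply: contraLR l_lt => /existsPn lV.
rewrite -leqNgt cardE; apply: uniq_leq_size (enum_uniq _) _ => v _.
by have := lV v; rewrite negbK.
Qed.

(** Greedy choice by counting.  The list handed to [outside] at each step names
    the vertices used so far and the neighbours to be avoided; it always has
    fewer than ten entries because [w2] is taken among the neighbours of [w4]
    (so the two spoil only one further vertex each for [w3]), and because the
    neighbour [a] of [x] and [y] is counted once. *)
Lemma hub_order_large : 10 <= #|V| ->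
  exists a l, [/\ uniq (a :: l), size (a :: l) = #|V| & hub_order e a l].
Proof.
move=> V_ge10.
have [a _] : exists a : V, a \notin [::] by apply: outside; rewrite (leq_trans _ V_ge10).
have [x [y [yx nba]]] := two_neighbours a.
have ax : e a x by rewrite nba eqxx.
have ay : e a y by rewrite nba eqxx orbT.
have [b ba nbx] := other_neighbour (etrans (e_sym x a) ax).
have [d da nby] := other_neighbour (etrans (e_sym y a) ay).
have [w4] := outside (l := [:: a; x; y; b; d]) (leq_trans (isT : 5 < 10) V_ge10).
rewrite !inE !negb_or => /and5P[w4a w4x w4y w4b w4d].
have [w2 [z2 [_ nbw4]]] := two_neighbours w4.
have w4w2 : e w4 w2 by rewrite nbw4 eqxx.
have [z3 _ nbw2] := other_neighbour (etrans (e_sym w2 w4) w4w2).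
(* [w1] is apart from [x] and [w2]; [z3] is the neighbour of [w2] other than [w4]. *)
have [w1] := outside (l := [:: a; x; y; b; w4; w2; z3])
  (leq_trans (isT : 7 < 10) V_ge10).
rewrite !inE !negb_or => /and5P[w1a w1x w1y w1b /and3P[w1w4 w1w2 w1z3]].
have [w3] := outside (l := [:: a; x; y; w1; w2; w4; z2; z3])
  (leq_trans (isT : 8 < 10) V_ge10).
rewrite !inE !negb_or => /and5P[w3a w3x w3y w3w1 /and4P[w3w2 w3w4 w3z2 w3z3]].
(* [v1] precedes [x] and [v2] follows [y] in the order. *)
have [v1] := outside (l := [:: a; x; y; w1; w2; w3; w4; b])
  (leq_trans (isT : 8 < 10) V_ge10).
rewrite !inE !negb_or => /and5P[v1a v1x v1y v1w1 /and4P[v1w2 v1w3 v1w4 v1b]].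
have [v2] := outside (l := [:: a; x; y; w1; w2; w3; w4; d; v1])
  (leq_trans (isT : 9 < 10) V_ge10).
rewrite !inE !negb_or => /and5P[v2a v2x v2y v2w1 /and5P[v2w2 v2w3 v2w4 v2d v2v1]].
have w2a : w2 != a.
  by apply: contraTneq w4w2 => ->; rewrite e_sym nba negb_or w4x.
have w2x : w2 != x.
  by apply: contraTneq w4w2 => ->; rewrite e_sym nbx negb_or w4a.
have w2y : w2 != y.
  by apply: contraTneq w4w2 => ->; rewrite e_sym nby negb_or w4a.
have w2w4 : w2 != w4 by apply: contraTneq w4w2 => ->; rewrite e_irr.
have xa : x != a by apply: contraTneq ax => ->; rewrite e_irr.
have ya : y != a by apply: contraTneq ay => ->; rewrite e_irr.
pose w := [:: w1; w2; w3; w4].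
(* The order will be a, v1, x, ..., y, v2; here the vertices placed by hand. *)
pose core := [:: a; v1; v2] ++ x :: rcons w y.
have core_uniq : uniq core.
  rewrite /= !inE !negb_or.
  do !(apply/andP; split) => //; by rewrite eq_sym.
have core_path : path (fun u v => ~~ e u v) x (rcons w y).
  rewrite /= nbx negb_or w1a w1b /= e_sym nbw2 negb_or w1w4 w1z3 /=.
  rewrite nbw2 negb_or w3w4 w3z3 /= e_sym nbw4 negb_or w3w2 w3z2 /=.
  by rewrite e_sym nby negb_or w4a w4d.
pose u := [seq v <- enum V | v \notin core].
have uw_uniq : uniq (u ++ core).
  rewrite cat_uniq core_uniq filter_uniq ?enum_uniq // andbT.
  by apply/hasPn => v vc; rewrite mem_filter vc.
have [|||w' w'P w'_path] := @insert_all_apart _ _ e_sym x y u w _ _ _ core_path.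
- by move=> v; have [z [z' [_ nb]]] := two_neighbours v; exists z, z' => v';
    rewrite nb => /orP[] /eqP; [left|right].
- by [].
- by apply: subseq_uniq uw_uniq; rewrite cat_subseq ?suffix_subseq.
pose l := v1 :: rcons (x :: rcons w' y) v2.
have alP : perm_eq (a :: l) (u ++ core).
  apply/permP => P; rewrite /l /= !count_cat /= -!cats1 !count_cat /= (permP w'P).
  by rewrite !count_cat /=; clear; lia.
have al_uniq : uniq (a :: l) by rewrite (perm_uniq alP).
have sz : size l = (size w').+4 by rewrite /l /= !size_rcons.
exists a, l; split => //.
  rewrite cardE; apply/perm_size/uniq_perm; rewrite ?enum_uniq //.
  move=> v; rewrite mem_enum (perm_mem alP) mem_cat mem_filter mem_enum andbT.
  by case: (v \in core).
apply/andP; split.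
  rewrite /l /= rcons_path /= [X in ~~ X && _]e_sym nbx negb_or v1a v1b w'_path /=.
  by rewrite last_rcons nby negb_or v2a v2d.
apply/allP => k; rewrite mem_iota => /andP[_ k_lt]; apply/implyP.
have l_uniq : uniq l by case/andP: al_uniq.
rewrite nba => /orP[]; move=> /eqP E; apply/orP; [left|right].
  by rewrite -(nth_uniq a _ _ l_uniq) ?E // sz.
rewrite -(nth_uniq a k_lt _ l_uniq) ?E ?sz ?subSS ?subn0 // /l /=.
by rewrite nth_rcons /= size_rcons ltnS leqnn nth_rcons ltnn eqxx.
Qed.
End TwoRegular.

(** * Hub orders on five to nine vertices *)

Definition edge_rel (E : seq (nat * nat)) : rel nat :=
  fun u v => ((u, v) \in E) || ((v, u) \in E).

Fixpoint subseqs_of_size (d : nat) (l : seq nat) : seq (seq nat) :=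
  if l is x :: l' then
    (if d is d'.+1 then map (cons x) (subseqs_of_size d' l') else [::]) ++ subseqs_of_size d l'
  else if d is 0 then [:: [::]] else [::].

Lemma subseq_of_size (A l : seq nat) : subseq A l -> A \in subseqs_of_size (size A) l.
Proof.
elim: l A => [|x l IHl] [|y A] //=; first by move=> _; exact: (IHl [::] (sub0seq _)).
rewrite mem_cat; case: eqP => [<- /IHl Al|_ /IHl ->]; last by rewrite orbT.
by rewrite map_f.
Qed.

(** Backtracking search; [p] is the reverse of the part of the order already
    placed. *)
Fixpoint complete (E : seq (nat * nat)) (n a fuel : nat) (p : seq nat) :
    option (seq nat) :=
  if fuel is fuel'.+1 then
    (fix try (vs : seq nat) : option (seq nat) :=
      if vs is v :: vs' then
        if [&& v \notin a :: p, if p is u :: _ then ~~ edge_rel E u v else true &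
               edge_rel E a v ==> (size p == 1) || (size p == n - 3)]
        then if complete E n a fuel' (v :: p) is Some l then Some l else try vs'
        else try vs'
      else None) (iota 0 n)
  else Some (rev p).

Fixpoint find_order (E : seq (nat * nat)) (n : nat) (hubs : seq nat) :
    nat * seq nat :=
  if hubs is a :: hubs' then
    if complete E n a n.-1 [::] is Some l then (a, l) else find_order E n hubs'
  else (0, [::]).

(** The answer of the search is tested here, so the value [true] is conclusive
    whatever the search does. *)
Definition has_order (n : nat) (E : seq (nat * nat)) : bool :=
  let: (a, l) := find_order E n (iota 0 n) in
  [&& uniq (a :: l), size (a :: l) == n, all (fun v => v < n) (a :: l) &
      hub_order (edge_rel E) a l].

(** Row by row enumeration of the graphs on [0, n) in which every vertex has degree
    two: [E] lists the edges with an end below [i], and the [k] vertices from [i]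
    on still have to choose their larger neighbours.  A vertex with [d] smaller
    neighbours must choose [2 - d] larger ones. *)
Fixpoint all_have_order (n k i : nat) (E : seq (nat * nat)) : bool :=
  if k is k'.+1 then
    let d := count (edge_rel E i) (iota 0 i) in
    if 2 < d then true else
    all (fun A => all_have_order n k' i.+1 ([seq (i, j) | j <- A] ++ E))
        (subseqs_of_size (2 - d) (iota i.+1 (n - i.+1)))
  else has_order n E.

Lemma all_have_orderP (n k i : nat) (E : seq (nat * nat)) (e : rel nat) :
  symmetric e -> (forall u, u < n -> ~~ e u u) ->
  (forall u, u < n -> count (e u) (iota 0 n) = 2) ->
  (forall u v, ((u, v) \in E) = [&& u < v, v < n, u < i & e u v]) ->
  i + k = n -> all_have_order n k i E ->
  exists a l, [/\ uniq (a :: l), size (a :: l) = n,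
    {in a :: l, forall v, v < n} & hub_order e a l].
Proof.
move=> e_sym e_irr e_reg; elim: k i E => [|k IHk] i E EP /= ik.
  rewrite /has_order; case: (find_order _ _ _) => a l.
  case/and4P=> ul /eqP sl /allP l_lt sp; exists a, l; split=> //.
  have Ee u v : u < n -> v < n -> edge_rel E u v = e u v.
    move=> u_lt v_lt; rewrite /edge_rel !EP [e v u]e_sym.
    have [->|uv] := eqVneq u v; first by rewrite ltnn (negbTE (e_irr _ v_lt)).
    case: (e u v); rewrite ?andbF //; clear -ik u_lt v_lt uv; lia.
  case/andP: sp => sl_path /allP al; apply/andP; split.
    apply: (sub_in_sorted (P := mem l)) sl_path; last exact/allP.
    by move=> u v ul' vl'; rewrite Ee // l_lt // inE ?ul' ?vl' orbT.
  apply/allP => j jl; have := al j jl; rewrite Ee // l_lt // inE ?eqxx // mem_nth ?orbT //.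
  by move: jl; rewrite mem_iota.
set d := count _ _.
have i_lt : i < n by lia.
pose A := [seq j <- iota i.+1 (n - i.+1) | e i j].
have dA : d + size A = 2.
  have nE : n = i + (n - i.+1).+1 by lia.
  have iotaE : iota 0 n = iota 0 i ++ i :: iota i.+1 (n - i.+1).
    by rewrite {1}nE iotaD.
  rewrite -(e_reg i i_lt) iotaE count_cat /= (negbTE (e_irr _ i_lt)) add0n.
  rewrite size_filter; congr (_ + _).
  apply: eq_in_count => j; rewrite mem_iota add0n /edge_rel !EP => j_lt.
  by rewrite [e j i]e_sym; case: (e i j); lia.
case: ifP => [|_ /allP]; first by lia.
have -> : 2 - d = size A by lia.
move=> /(_ A (subseq_of_size (filter_subseq _ _))); apply: IHk; last by lia.
move=> u v; rewrite mem_cat EP.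
have -> : ((u, v) \in [seq (i, j) | j <- A]) = (u == i) && (v \in A).
  apply/mapP/andP => [[j jA [-> ->]]|[/eqP-> vA]]; first by rewrite eqxx.
  by exists v.
rewrite mem_filter mem_iota; case: (eqVneq u i) => [->|]; first by case: (e i v); lia.
by case: (e u v); lia.
Qed.

(** Relabelling makes 1 and 2 the neighbours of 0, which divides the number of
    graphs to be enumerated by 28 when n = 9. *)
Lemma small_orders (n : nat) : 5 <= n < 10 ->
  all_have_order n n.-1 1 [:: (0, 1); (0, 2)].
Proof.
move=> n_small.
have /allP : all (fun m => all_have_order m m.-1 1 [:: (0, 1); (0, 2)]) (iota 5 5).
  by vm_compute.
by apply; rewrite mem_iota.
Qed.

Lemma hub_order_small (V : finType) (e : rel V) :
  simple_graph e -> regular_graph 2 e -> 5 <= #|V| < 10 ->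
  exists a l, [/\ uniq (a :: l), size (a :: l) = #|V| & hub_order e a l].
Proof.
move=> e_simple e_reg V_small; have [e_sym e_irr] := e_simple.
have [a _] : exists a : V, a \notin [::].
  by apply: outside; case/andP: V_small => + _; apply: leq_trans.
have [x [y [yx nba]]] := two_neighbours e_reg a.
have ax : e a x by rewrite nba eqxx.
have ay : e a y by rewrite nba eqxx orbT.
have xa : x != a by apply: contraTneq ax => ->; rewrite e_irr.
have ya : y != a by apply: contraTneq ay => ->; rewrite e_irr.
pose rest := [seq v <- enum V | v \notin [:: a; x; y]].
pose s := [:: a; x; y] ++ rest.
have s_uniq : uniq s.
  rewrite cat_uniq filter_uniq ?enum_uniq // andbT /= !inE !negb_or.
  rewrite ![a == _]eq_sym xa ya [x == y]eq_sym yx /=.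
  by apply/hasPn => v; rewrite mem_filter => /andP[].
have s_enum : perm_eq s (enum V).
  apply: uniq_perm => //; first exact: enum_uniq.
  by move=> v; rewrite mem_cat mem_filter mem_enum andbT; case: (v \in _).
have sizes : size s = #|V| by rewrite (perm_size s_enum) cardE.
pose f := nth a s.
pose e' u v := e (f u) (f v).
have f_iota : map f (iota 0 #|V|) = s by rewrite -sizes; exact: (mkseq_nth a s).
have [|||||b [l [ul sl l_lt sp]]] :=
  @all_have_orderP #|V| #|V|.-1 1 _ e' _ _ _ _ _ (small_orders V_small).
- by move=> u v; rewrite /e' e_sym.
- by move=> u _; rewrite /e' e_irr.
- move=> u _; rewrite -(e_reg (f u)) -[LHS](count_map f) f_iota.
  by rewrite (permP s_enum) -size_filter cardE enumT.
- move=> u v; rewrite !inE !xpair_eqE /e'.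
  case: u => [|u] /=; last by rewrite ?andbF.
  rewrite nba; case: (ltnP v #|V|) => [v_lt|]; last by lia.
  rewrite -[x]/(f 1) -[y]/(f 2) !nth_uniq // ?sizes //; lia.
- by lia.
exists (f b), (map f l).
have f_inj : {in b :: l &, injective f}.
  by move=> u v /l_lt ul' /l_lt vl' /eqP; rewrite nth_uniq ?sizes // => /eqP.
split; first by rewrite -[_ :: _]/(map f (b :: l)) map_inj_in_uniq.
  by rewrite /= size_map.
case/andP: sp => sp /allP spk; apply/andP; split; first by rewrite sorted_map.
rewrite size_map; apply/allP => k kl; rewrite (nth_map b); first exact: spk.
by move: kl; rewrite mem_iota.
Qed.

Lemma hub_order_exists (V : finType) (e : rel V) :
  simple_graph e -> regular_graph 2 e -> 5 <= #|V| ->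
  exists a l, [/\ uniq (a :: l), size (a :: l) = #|V| & hub_order e a l].
Proof.
move=> e_simple e_reg V_ge5; case: (ltnP #|V| 10) => V10.
  by apply: hub_order_small => //; rewrite V_ge5.
exact: hub_order_large.
Qed.

Import Order.TTheory GRing.Theory Num.Theory.
Import numFieldNormedType.Exports.
Local Open Scope classical_set_scope.
Local Open Scope ring_scope.

(** * Orientation and segments in the plane *)

Section Plane.
Context {R : realType}.
Implicit Types (a b c d x y : R * R) (s : R) (A B C : set (R * R)).

(** Twice the signed area of the triangle [a b c], positive when it is
    counterclockwise. *)
Definition orient a b c : R :=
  (b.1 - a.1) * (c.2 - a.2) - (b.2 - a.2) * (c.1 - a.1).

Definition line a b s : R * R := (1 - s) *: a + s *: b.

Lemma line1E a b s : (line a b s).1 = (1 - s) * a.1 + s * b.1.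
Proof. by []. Qed.
Lemma line2E a b s : (line a b s).2 = (1 - s) * a.2 + s * b.2.
Proof. by []. Qed.
Definition lineE := (line1E, line2E).

Lemma segmentP a b x :
  segment a b x <-> exists2 s, 0 <= s <= 1 & x = line a b s.
Proof.
split=> [[s /=]|[s s01 ->]]; first by rewrite in_itv /= => s01 <-; exists s.
by exists s => //=; rewrite in_itv.
Qed.

Lemma line0 a b : line a b 0 = a.
Proof. by rewrite /line subr0 scale1r scale0r addr0. Qed.
Lemma line1 a b : line a b 1 = b.
Proof. by rewrite /line subrr scale1r scale0r add0r. Qed.

Lemma segment_l a b : segment a b a.
Proof. by apply/segmentP; exists 0; rewrite ?line0 ?lexx ?ler01. Qed.
Lemma segment_r a b : segment a b b.
Proof. by apply/segmentP; exists 1; rewrite ?line1 ?lexx ?ler01. Qed.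

Lemma segmentC a b : segment a b = segment b a.
Proof.
apply/seteqP; split=> x /segmentP[s s01 ->]; apply/segmentP; exists (1 - s).
- by lra.
- by rewrite /line subKr addrC.
- by lra.
- by rewrite /line subKr addrC.
Qed.

Lemma orient_line a b c d s :
  orient a b (line c d s) = (1 - s) * orient a b c + s * orient a b d.
Proof. by rewrite /orient !lineE; ring. Qed.

Lemma orient_cycle a b c : orient a b c = orient b c a.
Proof. by rewrite /orient; ring. Qed.
Lemma orient_swap a b c : orient b a c = - orient a b c.
Proof. by rewrite /orient; ring. Qed.
Lemma orient_flip a b c : orient a c b = - orient a b c.
Proof. by rewrite /orient; ring. Qed.
Lemma orient_l a b : orient a b a = 0.
Proof. by rewrite /orient; ring. Qed.
Lemma orient_r a b : orient a b b = 0.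
Proof. by rewrite /orient; ring. Qed.

Lemma collinear_line a b x : a != b -> orient a b x = 0 -> exists s, x = line a b s.
Proof.
case: a b x => [a1 a2] [b1 b2] [x1 x2]; rewrite /orient /= => ab o0.
have [e1|n1] := eqVneq b1 a1.
  have n2 : b2 - a2 != 0.
    by rewrite subr_eq0; apply: contraNneq ab => ->; rewrite e1.
  exists ((x2 - a2) / (b2 - a2)); congr pair; rewrite /=.
    have /eqP : (b2 - a2) * (x1 - a1) = 0 by rewrite e1 in o0; lra.
    rewrite mulf_eq0 (negbTE n2) /= subr_eq0 => /eqP->.
    by rewrite -![_ *: _]/(_ * _) e1; ring.
  by rewrite -![_ *: _]/(_ * _); field.
have n2 : b1 - a1 != 0 by rewrite subr_eq0.
exists ((x1 - a1) / (b1 - a1)); congr pair; rewrite /=.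
  by rewrite -![_ *: _]/(_ * _); field.
rewrite -![_ *: _]/(_ * _).
have -> : x2 = a2 + (b2 - a2) * (x1 - a1) / (b1 - a1).
  have -> : (b2 - a2) * (x1 - a1) = (b1 - a1) * (x2 - a2) by lra.
  by field.
by field.
Qed.

Definition segment_closed C := forall x y, C x -> C y -> segment x y `<=` C.

(** The three orientations of [x], divided by that of the triangle, are the
    barycentric coordinates of [x]; two steps along segments reach [x] from the
    vertices. *)
Lemma triangle_sub C a b c x : segment_closed C -> C a -> C b -> C c ->
  0 < orient a b c ->
  0 <= orient a b x -> 0 <= orient b c x -> 0 <= orient c a x -> C x.
Proof.
move=> cC Ca Cb Cc D0 w0 u0 v0.
set D := orient a b c in D0; set w := orient a b x in w0.
set u := orient b c x in u0; set v := orient c a x in v0.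
(* [u + v + w = D] and [D x = u a + v b + w c] are the barycentric identities. *)
have uvw : D = u + v + w by rewrite /D /u /v /w /orient; ring.
have x1E : D * x.1 = u * a.1 + v * b.1 + w * c.1.
  by rewrite /D /u /v /w /orient; ring.
have x2E : D * x.2 = u * a.2 + v * b.2 + w * c.2.
  by rewrite /D /u /v /w /orient; ring.
clearbody D u v w.
have Dn0 : D != 0 by rewrite gt_eqF.
have xE1 : x.1 = (u * a.1 + v * b.1 + w * c.1) / D by rewrite -x1E; field.
have xE2 : x.2 = (u * a.2 + v * b.2 + w * c.2) / D by rewrite -x2E; field.
have [uv0|uv_neq0] := eqVneq (u + v) 0.
  have [u_0 v_0] : u = 0 /\ v = 0 by split; lra.
  rewrite (_ : x = c) // [x]surjective_pairing [c]surjective_pairing xE1 xE2.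
  have -> : w = D by lra.
  by rewrite u_0 v_0; congr pair => /=; field.
have uv_gt0 : 0 < u + v by rewrite lt_neqAle eq_sym uv_neq0 addr_ge0.
pose y := line a b (v / (u + v)).
have Cy : C y.
  apply: (cC a b) => //; apply/segmentP; exists (v / (u + v)) => //.
  by rewrite divr_ge0 ?(ltW uv_gt0) ?(ltW D0) //= ler_pdivrMr // mul1r; lra.
apply: (cC y c) => //; apply/segmentP; exists (w / D).
  by rewrite divr_ge0 ?(ltW uv_gt0) ?(ltW D0) //= ler_pdivrMr // mul1r; lra.
rewrite [x]surjective_pairing xE1 xE2 [RHS]surjective_pairing !lineE.
by congr pair; rewrite uvw; field; rewrite -uvw uv_neq0 Dn0.
Qed.

Lemma segment_closed_convex C :
  segment_closed C -> convex_set (C : set (convex_lmodType (R * R)%type)).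
Proof.
move=> cC x y l; rewrite !inE => Cx Cy; apply: (cC x y) => //.
rewrite segmentC; apply/segmentP; exists l%:num; first by rewrite ge0 le1.
by rewrite /line addrC.
Qed.

Lemma conv_hull_segment_closed A : segment_closed (conv_hull A).
Proof.
move=> x y hx hy z /segmentP[s s01 ->] C [cC AC].
case/andP: s01 => s0 s1.
have := cC y x (Itv01 s0 s1); rewrite !inE.
rewrite [line x y s]addrC => conv_yx.
by apply: conv_yx; [exact: hy|exact: hx].
Qed.

Lemma conv_hull_min A C : segment_closed C -> A `<=` C -> conv_hull A `<=` C.
Proof. by move=> cC; apply: smallest_sub; exact: segment_closed_convex. Qed.

Lemma line_continuous a b : continuous (line a b).
Proof.
move=> s; apply: cvgD; apply: cvgZr_tmp; last exact: cvg_id.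
by apply: cvgB; [exact: cvg_cst|exact: cvg_id].
Qed.

Lemma orient_continuous a b : continuous (orient a b).
Proof.
move=> x; apply: cvgB; apply: cvgM; try exact: cvg_cst.
  by apply: cvgB; [exact: cvg_snd|exact: cvg_cst].
by apply: cvgB; [exact: cvg_fst|exact: cvg_cst].
Qed.

(** Used with both signs of [s]: towards [c] to leave the boundary inwards, away
    from [c] to leave it outwards. *)
Lemma nbhs_line x c A : nbhs x A -> exists2 r, 0 < r & forall s, `|s| < r -> A (line x c s).
Proof.
rewrite -{1}(line0 x c) => /(@line_continuous x c 0) /nbhs_ballP[r /= r0 rA].
by exists r => // s sr; apply: rA; rewrite /ball /= sub0r normrN.
Qed.

Lemma segment_closed_connected C x : C x -> segment_closed C -> connected C.
Proof.
move=> Cx cC.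
have -> : C = \bigcup_(y in C) segment x y.
  apply/seteqP; split=> [y Cy|y [z Cz]]; last exact: cC.
  by exists y => //; exact: segment_r.
apply: bigcup_connected; first by exists x => y _; exact: segment_l.
move=> y _; apply: connected_continuous_connected.
  by apply/connected_intervalP/interval_is_interval.
by apply: continuous_subspaceT; exact: line_continuous.
Qed.
End Plane.

(** * Convex polygons *)

Lemma next_neq (T : eqType) (c : seq T) (i : T) :
  uniq c -> (2 < size c)%N -> i \in c ->
  [/\ next c i != i, next c (next c i) != i & next c (next c i) != next c i].
Proof.
move=> uc c3 ic; have [n s cE] := rot_to ic.
rewrite -!(next_rot n uc) cE.
have : uniq (i :: s) by rewrite -cE rot_uniq.
have : (2 < size (i :: s))%N by rewrite -cE size_rot.
case: s {cE} => [|j [|k s]] //= _; rewrite !inE !negb_or eqxx.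
case/and3P=> /and3P[ij ik _] /andP[jk _] _.
by rewrite !(eq_sym _ i) (negbTE ij) eqxx ik eq_sym jk.
Qed.

Section Polygon.
Context {R : realType} {I : eqType}.
Implicit Types (q : I -> R * R) (c : seq I) (x y : R * R).

(** Strict convexity with counterclockwise vertices: all the vertices off an edge
    lie strictly on its left. *)
Definition convex_polygon q c := [/\ uniq c, (2 < size c)%N &
  forall i m, i \in c -> m \in c -> m != i -> m != next c i ->
    0 < orient (q i) (q (next c i)) (q m)].

Definition edge_line q c i := orient (q i) (q (next c i)).

Definition open_polygon q c : set (R * R) :=
  [set x | forall i, i \in c -> 0 < edge_line q c i x].

Definition closed_polygon q c : set (R * R) :=
  [set x | forall i, i \in c -> 0 <= edge_line q c i x].

Definition boundary q c : set (R * R) :=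
  [set x | exists2 i, i \in c & segment (q i) (q (next c i)) x].

Lemma open_sub_closed q c : open_polygon q c `<=` closed_polygon q c.
Proof. by move=> x xo i ic; rewrite ltW // xo. Qed.

Lemma open_polygon_open q c : open (open_polygon q c).
Proof.
rewrite /open_polygon; elim: {1}c => [|j d IHd].
  rewrite (_ : [set _ | _] = setT); first exact: openT.
  by apply/seteqP; split.
rewrite (_ : [set _ | _] = [set x | 0 < edge_line q c j x] `&`
  [set x | forall i, i \in d -> 0 < edge_line q c i x]).
  apply: openI => //.
  exact: (open_comp (fun x _ => orient_continuous (x := x)) (open_gt (y := 0))).
apply/seteqP; split=> [x xd|x [xj xd] i].
  by split=> [|i id]; apply: xd; rewrite inE ?eqxx ?id ?orbT.
by rewrite inE => /orP[/eqP->|/xd].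
Qed.

Lemma closed_polygon_closed q c : closed (closed_polygon q c).
Proof.
rewrite (_ : closed_polygon q c =
  \bigcap_(i in [set` c]) [set x | 0 <= edge_line q c i x]) //.
apply: closed_bigI => i _.
exact: (closed_comp (fun x _ => orient_continuous (x := x)) (closed_ge (y := 0))).
Qed.

Lemma open_polygon_segment_closed q c : segment_closed (open_polygon q c).
Proof.
move=> x y xo yo z /segmentP[s s01 ->] i ic; rewrite /edge_line orient_line.
have := xo i ic; have := yo i ic; rewrite /edge_line.
by move: (orient _ _ y) (orient _ _ x) => u v; nra.
Qed.

Lemma closed_polygon_segment_closed q c : segment_closed (closed_polygon q c).
Proof.
move=> x y xo yo z /segmentP[s s01 ->] i ic; rewrite /edge_line orient_line.
have := xo i ic; have := yo i ic; rewrite /edge_line.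
by move: (orient _ _ y) (orient _ _ x) => u v; nra.
Qed.

Section Convex.
Context (q : I -> R * R) (c : seq I).
Hypothesis qc : convex_polygon q c.

Let c_uniq : uniq c. Proof. by case: qc. Qed.
Let c_ge3 : (2 < size c)%N. Proof. by case: qc. Qed.
Let qcP i m : i \in c -> m \in c -> m != i -> m != next c i ->
  0 < edge_line q c i (q m).
Proof. by case: qc => _ _; apply. Qed.

Lemma vertex_closed_polygon i : i \in c -> closed_polygon q c (q i).
Proof.
move=> ic j jc; have [->|ij] := eqVneq i j; first by rewrite /edge_line orient_l.
have [->|ij'] := eqVneq i (next c j); first by rewrite /edge_line orient_r.
by rewrite ltW // qcP.
Qed.

Lemma boundary_sub_closed : boundary q c `<=` closed_polygon q c.
Proof.
move=> x [i ic]; apply: closed_polygon_segment_closed.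
  exact: vertex_closed_polygon.
by apply: vertex_closed_polygon; rewrite mem_next.
Qed.

Lemma next2_edge_line i : i \in c -> 0 < edge_line q c i (q (next c (next c i))).
Proof.
by move=> ic; have [? ? ?] := next_neq c_uniq c_ge3 ic; rewrite qcP ?mem_next.
Qed.

(** On the line of an edge, the half-planes of the previous and of the next edge
    bound the parameter below by 0 and above by 1. *)
Lemma edge_line_eq0 x i : closed_polygon q c x -> i \in c ->
  edge_line q c i x = 0 -> segment (q i) (q (next c i)) x.
Proof.
move=> xc ic x0; have [n1 n2 n3] := next_neq c_uniq c_ge3 ic.
have qij : q i != q (next c i).
  by apply/eqP => E; have := next2_edge_line ic; rewrite /edge_line -E /orient; lra.
have [s xE] := collinear_line qij x0.
apply/segmentP; exists s => //.
have jc : next c i \in c by rewrite mem_next.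
have hc : prev c i \in c by rewrite mem_prev.
have hi : next c (prev c i) = i by rewrite next_prev.
have [m1 m2 m3] := next_neq c_uniq c_ge3 hc.
rewrite hi in m1 m2 m3.
have after : 0 < edge_line q c (next c i) (q i) by rewrite qcP // eq_sym.
have before : 0 < edge_line q c (prev c i) (q (next c i)) by rewrite qcP // hi.
have := xc _ jc; have := xc _ hc; move: after before.
rewrite xE /edge_line !orient_line hi orient_l orient_r.
move: (orient _ _ _) (orient _ _ _) => u v; nra.
Qed.

Lemma closed_not_boundary x :
  closed_polygon q c x -> ~ boundary q c x -> open_polygon q c x.
Proof.
move=> xc xb i ic; rewrite lt_neqAle (xc i ic) andbT eq_sym.
by apply/eqP => x0; apply: xb; exists i => //; exact: edge_line_eq0.
Qed.

Lemma open_not_boundary x : open_polygon q c x -> ~ boundary q c x.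
Proof.
move=> xo [i ic /segmentP[s _ xE]]; have := xo i ic.
by rewrite xE /edge_line orient_line orient_l orient_r !mulr0 addr0 ltxx.
Qed.

(** From a point on the line of an edge, moving away from a vertex off that line
    leaves the half-plane at once. *)
Lemma interior_closed_polygon : interior (closed_polygon q c) `<=` open_polygon q c.
Proof.
move=> x xi; have xc := interior_subset xi.
move=> i ic; rewrite lt_neqAle (xc i ic) andbT eq_sym; apply/eqP => x0.
pose m := next c (next c i).
have [r r0 rU] := nbhs_line (q m) xi.
have /rU/(_ i ic) : `|- (r / 2)| < r.
  by rewrite normrN gtr0_norm ?divr_gt0 // ltr_pdivrMr // ltr_pMr // ltr1n.
have := next2_edge_line ic; rewrite -/m.
move: x0; rewrite /edge_line orient_line => ->.
by move: (orient _ _ _) => u; nra.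
Qed.

(** A point of the closed polygon is approached along the segment from an interior
    point, on which every edge inequality is strict. *)
Lemma closure_open_polygon x0 : open_polygon q c x0 ->
  closure (open_polygon q c) = closed_polygon q c.
Proof.
move=> x0o; apply/seteqP; split.
  rewrite [X in _ `<=` X](iffLR (closure_id _)); last exact: closed_polygon_closed.
  by apply: closureS; exact: open_sub_closed.
move=> x xc U /(nbhs_line x0)[r r0 rU].
(* Below [r] to stay in the neighbourhood, below 1 to stay strictly inside. *)
pose s := Num.min (r / 2) (2^-1).
have s0 : 0 < s by rewrite lt_min !divr_gt0 //= invr_gt0.
have s1 : s < 1 by rewrite gt_min invf_lt1 // ltr1n orbT.
have sr : s < r by rewrite gt_min ltr_pdivrMr // ltr_pMr // ltr1n.
exists (line x x0 s); split; last by apply: rU; rewrite gtr0_norm.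
move=> i ic; have := xc i ic; have := x0o i ic; rewrite /edge_line orient_line.
by clearbody s; move: (orient _ _ _) (orient _ _ _) => u v; nra.
Qed.

Lemma frontier_open_polygon x0 : open_polygon q c x0 ->
  frontier (open_polygon q c) = boundary q c.
Proof.
move=> x0o; rewrite /frontier (closure_open_polygon x0o).
rewrite (iffLR (interior_id _)); last exact: open_polygon_open.
apply/seteqP; split=> [x [xc xo]|x xb].
  by apply: contrapT => /(closed_not_boundary xc).
by split; [exact: boundary_sub_closed|move=> /open_not_boundary].
Qed.

(** The open polygon is convex, hence connected, and it is clopen in the component:
    its closure adds only boundary points, which belong to [D]. *)
Lemma component_open_polygon (D : set (R * R)) x : open_polygon q c x ->
  open_polygon q c `<=` ~` D -> boundary q c `<=` D ->
  connected_component (~` D) x = open_polygon q c.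
Proof.
move=> xo oD bD; apply/seteqP; split; last first.
  apply: connected_component_max => //.
  by apply: segment_closed_connected xo _; exact: open_polygon_segment_closed.
set K := connected_component _ _.
have KD : K `<=` ~` D by exact: connected_component_sub.
have Kx : K x by apply: connected_component_refl; exact: oD.
have KE : K `&` open_polygon q c = K `&` closed_polygon q c.
  apply/seteqP; split=> y [Ky yc]; split => //; first exact: open_sub_closed.
  by apply: closed_not_boundary yc _ => /bD; exact: KD.
suff -> : K = K `&` open_polygon q c by move=> y [].
apply/esym; apply: (component_connected (A := ~` D) (x := x)).
- by exists x.
- by exists (open_polygon q c) => //; exact: open_polygon_open.
- by exists (closed_polygon q c) => //; exact: closed_polygon_closed.
Qed.
Lemma frontier_closed_polygon : frontier (closed_polygon q c) = boundary q c.
Proof.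
rewrite /frontier -(iffLR (closure_id _)); last exact: closed_polygon_closed.
apply/seteqP; split=> [x [xc xi]|x xb].
  apply: contrapT => /(closed_not_boundary xc) xo; apply: xi.
  apply: (interiorS (@open_sub_closed q c)).
  by rewrite (iffLR (interior_id _)) //; exact: open_polygon_open.
split; first exact: boundary_sub_closed.
by move=> /interior_closed_polygon/open_not_boundary.
Qed.

(** Otherwise the midpoint lies strictly inside: no edge line contains both
    ends. *)
Lemma segment_boundary_next i j : i \in c -> j \in c -> i != j ->
  segment (q i) (q j) `<=` boundary q c -> j = next c i \/ i = next c j.
Proof.
move=> ic jc ij /(_ (line (q i) (q j) 2^-1)) mid_b.
apply: contrapT => /not_orP[/eqP ji /eqP ij'].
apply: (@open_not_boundary (line (q i) (q j) 2^-1)); last first.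
  by apply: mid_b; apply/segmentP; exists 2^-1 => //; lra.
move=> l lc; rewrite /edge_line orient_line.
have := vertex_closed_polygon ic lc; have := vertex_closed_polygon jc lc.
rewrite /edge_line => jl_ge0 il_ge0.
have [li|il] := eqVneq i l.
  have := qcP ic jc; rewrite eq_sym => /(_ ij ji).
  by move: jl_ge0 il_ge0; rewrite -li /edge_line; lra.
have [lj|jl] := eqVneq j l.
  have := qcP jc ic ij ij'.
  by move: jl_ge0 il_ge0; rewrite -lj /edge_line; lra.
have [il'|il'] := eqVneq i (next c l).
  have := qcP lc jc jl; rewrite -il' eq_sym => /(_ ij).
  by move: il_ge0; rewrite /edge_line -il'; lra.
by have := qcP lc ic il il'; rewrite /edge_line; lra.
Qed.
End Convex.
End Polygon.

(** * Fans and their cells *)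

Lemma next_cons_iota (a m i : nat) : (0 < a)%N -> i \in 0%N :: iota a m ->
  next (0%N :: iota a m) i =
    if i == 0%N then nth 0%N (iota a m) 0 else
    if (i.+1 < a + m)%N then i.+1 else 0%N.
Proof.
move=> a_gt0 ic; rewrite next_nth ic /= [0%N == i]eq_sym; case: eqVneq => // i0.
move: ic; rewrite inE (negbTE i0) mem_iota => /= /andP[ai iam].
have -> : index i (iota a m) = (i - a)%N.
  have {1}-> : i = nth 0%N (iota a m) (i - a) by rewrite nth_iota ?subnKC //; lia.
  by rewrite index_uniq ?iota_uniq // size_iota; lia.
case: ltnP => im; first by rewrite nth_iota; lia.
by rewrite nth_default // size_iota; lia.
Qed.

(** The case [j = 1] of the chords repeats the side [0, 1]; with n = 2 modulo [d] the
    case [j = n - 1] is the closing side of the hull. *)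
Definition fan (d : nat) : rel nat := fun i j =>
  [|| j == i.+1, i == j.+1, (i == 0%N) && ((j %% d)%N == 1%N)
    | (j == 0%N) && ((i %% d)%N == 1%N)].

Lemma fan_sym d : symmetric (fan d).
Proof. by move=> i j; rewrite /fan orbCA; congr [|| _, _ | _]; rewrite orbC. Qed.

Lemma fan_irr d : irreflexive (fan d).
Proof. by case=> [|i]; rewrite /fan ?mod0n /=; lia. Qed.

Lemma fan_lt d i j : (i < j)%N -> fan d i j -> j = i.+1 \/ i = 0%N.
Proof.
move=> ij; have [->|i0] := eqVneq i 0%N; first by right.
by rewrite /fan (negbTE i0) /= => fij; left; lia.
Qed.

(** The [k]-th cell: the centre and the [d + 1] consecutive positions from one chord
    to the next, so [d + 2 = g] vertices. *)
Definition cell (d k : nat) := 0%N :: iota (k * d).+1 d.+1.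

Lemma mem_cell d k i : (i \in cell d k) = (i == 0%N) || (k * d < i <= k.+1 * d + 1)%N.
Proof. by rewrite inE mem_iota; congr (_ || _); lia. Qed.

Lemma next_cell d k i : i \in cell d k -> next (cell d k) i =
  if i == 0%N then (k * d).+1 else if (i <= k.+1 * d)%N then i.+1 else 0%N.
Proof.
move=> ic; rewrite next_cons_iota //; case: eqVneq => // i0.
by congr (if _ then _ else _); lia.
Qed.

Lemma cell_fan d k i : (1 < d)%N -> i \in cell d k -> fan d i (next (cell d k) i).
Proof.
move=> d_ge2 ic; rewrite next_cell // /fan; move: ic; rewrite mem_cell.
have mod1 m : ((m * d).+1 %% d)%N = 1%N by rewrite -addn1 modnMDl modn_small.
case: eqVneq => [->|i0] /=; first by rewrite mod1 /= !orbT.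
move=> ikd; have [ik|ik] := leqP i (k.+1 * d); first by rewrite eqxx.
have -> : i = (k.+1 * d).+1 by lia.
by rewrite mod1 !orbT.
Qed.

(** * Points listed counterclockwise *)

Lemma sign_change (R : realType) (f : nat -> R) (m : nat) :
  (0 < m)%N -> 0 <= f 0%N -> f m <= 0 ->
  exists2 k, (k < m)%N & 0 <= f k /\ f k.+1 <= 0.
Proof.
elim: m => // m IHm _ f0 fm.
have [fm0|fm0] := leP 0 (f m); first by exists m.
have [m0|m_gt0] := posnP m; first by rewrite m0 in fm0; move: fm0; lra.
have [k km fk] := IHm m_gt0 f0 (ltW fm0).
by exists k => //; rewrite ltnW.
Qed.

Section ConvexChain.
Context {R : realType} (q : nat -> R * R) (n : nat).
Implicit Types (x : R * R) (c : seq nat).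

Definition ccw := forall i j k, (i < j)%N -> (j < k)%N -> (k < n)%N ->
  0 < orient (q i) (q j) (q k).
Hypothesis q_ccw : ccw.

(** The next vertex of an increasing cycle is the next larger one, or the least one
    after the greatest; so an edge and a third vertex are always a cyclic
    rotation of an increasing triple. *)
Lemma sorted_convex_polygon c :
  sorted ltn c -> (2 < size c)%N -> all (fun i => i < n)%N c -> convex_polygon q c.
Proof.
move=> cs c3 /allP cn; have cu := sorted_uniq ltn_trans ltnn cs.
split=> // _ _ /(nthP 0%N)[a a_lt <-] /(nthP 0%N)[b b_lt <-].
have ltc := sorted_ltn_nth ltn_trans 0%N cs.
have lt_n e : (e < size c)%N -> (nth 0%N c e < n)%N by move=> ?; apply/cn/mem_nth.
have -> : next c (nth 0%N c a) = nth 0%N c (if (a.+1 < size c)%N then a.+1 else 0%N).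
  rewrite next_nth mem_nth // index_uniq //.
  case: c {cs cn cu ltc lt_n c3 b_lt} a_lt => // y c' a_lt; rewrite /= ltnS.
  by case: ltnP => ac; [apply: set_nth_default|rewrite nth_default].
have [a_last|a_last] := ltnP a.+1 (size c); rewrite !nth_uniq //; last by lia.
  move=> ba ba1; have [ab|ab] := ltnP a b.
    by apply: q_ccw; rewrite ?lt_n //; apply: ltc; rewrite ?inE //; lia.
  rewrite -orient_cycle; apply: q_ccw; rewrite ?lt_n //; apply: ltc; rewrite ?inE //; lia.
move=> ba b0; rewrite orient_cycle.
apply: q_ccw; rewrite ?lt_n //; apply: ltc; rewrite ?inE //.
- by lia.
- by rewrite lt0n.
- by rewrite ltn_neqAle ba -ltnS (leq_trans b_lt).
Qed.

Lemma orient0_le i j : (i <= j)%N -> (j < n)%N -> orient (q 0%N) (q j) (q i) <= 0.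
Proof.
rewrite leq_eqVlt => /orP[/eqP->|ij jn]; first by rewrite orient_r.
case: i ij => [|i] ij; first by rewrite orient_l.
by rewrite orient_flip oppr_le0 ltW // q_ccw.
Qed.

Lemma orient0_ge i j : (i <= j)%N -> (j < n)%N -> 0 <= orient (q 0%N) (q i) (q j).
Proof. by move=> ij jn; rewrite orient_flip oppr_ge0 orient0_le. Qed.

Definition hull_polygon := iota 0 n.

Lemma next_hull i : (i < n)%N ->
  next hull_polygon i = if (i.+1 < n)%N then i.+1 else 0%N.
Proof.
rewrite /hull_polygon; case: n => // m im.
have idx : index i (iota 0 m.+1) = i.
  have {1}-> : i = nth 0%N (iota 0 m.+1) i by rewrite nth_iota.
  by rewrite index_uniq ?iota_uniq ?size_iota.
rewrite next_nth mem_iota add0n im idx -[iota 0 m.+1]/(0%N :: iota 1 m).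
rewrite ltnS; case: ltnP => im1; first by rewrite nth_iota.
by rewrite nth_default // size_iota.
Qed.

Hypothesis n_gt2 : (2 < n)%N.

Lemma hull_polygon_convex : convex_polygon q hull_polygon.
Proof.
apply: sorted_convex_polygon; rewrite ?size_iota //; first exact: iota_ltn_sorted.
by apply/allP => i; rewrite mem_iota.
Qed.

Let S := [set q i | i in [set i | (i < n)%N]].

(** A point of the closed polygon lies between two consecutive rays from [q 0], by
    a change of sign of [orient (q 0) (q k) x] in [k], hence in the triangle that
    the two vertices form with [q 0]. *)
Lemma hull_polygonE : conv_hull S = closed_polygon q hull_polygon.
Proof.
have hull_in i : (i < n)%N -> i \in hull_polygon by rewrite mem_iota.
apply/seteqP; split=> [|x xc].
  apply: conv_hull_min; first exact: closed_polygon_segment_closed.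
  move=> _ [i i_lt <-]; apply: vertex_closed_polygon; last exact: hull_in.
  exact: hull_polygon_convex.
have hull_q i : (i < n)%N -> conv_hull S (q i).
  by move=> i_lt; apply: sub_gen_smallest; exists i.
have x_first := xc 0%N (hull_in 0%N ltac:(lia)).
have x_last := xc n.-1 (hull_in n.-1 ltac:(lia)).
rewrite /edge_line next_hull in x_first; last by lia.
rewrite ifT in x_first; last by lia.
rewrite /edge_line next_hull in x_last; last by lia.
rewrite ifF in x_last; last by lia.
pose f k := orient (q 0%N) (q k.+1) x.
have [||k kn [fk fk1]] := @sign_change R f n.-2 _ x_first.
- by lia.
- have n1 : n.-2.+1 = n.-1 by lia.
  by rewrite /f n1 orient_swap oppr_le0.
have := xc k.+1 (hull_in k.+1 ltac:(lia)).
rewrite /edge_line next_hull ?ifT => [x_k||]; [|lia|lia].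
apply: (triangle_sub (@conv_hull_segment_closed _ S)
  (hull_q 0%N _) (hull_q k.+1 _) (hull_q k.+2 _)) => //; try lia.
- by apply: q_ccw; lia.
- by rewrite orient_swap oppr_ge0.
Qed.

Lemma hull_frontier_edge i j : (i < n)%N -> (j < n)%N -> i != j ->
  segment (q i) (q j) `<=` frontier (conv_hull S) ->
  j = next hull_polygon i \/ i = next hull_polygon j.
Proof.
move=> i_lt j_lt ij; rewrite hull_polygonE frontier_closed_polygon; last first.
  exact: hull_polygon_convex.
by apply: segment_boundary_next => //; rewrite ?mem_iota //; exact: hull_polygon_convex.
Qed.

Lemma hull_edge_frontier i : (i < n)%N ->
  segment (q i) (q (next hull_polygon i)) `<=` frontier (conv_hull S).
Proof.
move=> i_lt; rewrite hull_polygonE frontier_closed_polygon; last first.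
  exact: hull_polygon_convex.
by move=> x xi; exists i => //; rewrite mem_iota.
Qed.

Section Fan.
Variables (d t : nat).
Hypotheses (d_ge2 : (2 <= d)%N) (nE : n = (t.+1 * d + 2)%N).
Local Notation fan := (fan d).
Local Notation cell := (cell d).

Lemma cell_lt k i : (k <= t)%N -> i \in cell k -> (i < n)%N.
Proof. by rewrite mem_cell nE; nia. Qed.

Lemma cell_polygon k : (k <= t)%N -> convex_polygon q (cell k).
Proof.
move=> kt; apply: sorted_convex_polygon.
- exact: (iota_ltn_sorted (k * d).+1 d.+1).
- by rewrite /cell -cat1s size_cat size_iota add1n ltnS ltnW.
- by apply/allP => i ic; apply: (cell_lt kt).
Qed.

Definition fan_drawing : set (R * R) :=
  [set x | exists i j, [/\ (i < n)%N, (j < n)%N, fan i j & segment (q i) (q j) x]].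

Lemma cell_boundary k : (k <= t)%N -> boundary q (cell k) `<=` fan_drawing.
Proof.
move=> kt x [i ic xi]; exists i, (next (cell k) i); split=> //.
- exact: cell_lt ic.
- by apply: (cell_lt kt); rewrite mem_next.
- exact: cell_fan d_ge2 ic.
Qed.

(** Either the edge is a side of the cell, or it lies beyond one of the two sides
    of the cell at the centre. *)
Lemma cell_beyond k i j : (k <= t)%N -> (i < j)%N -> (j < n)%N -> fan i j ->
  exists2 l, l \in cell k &
    edge_line q (cell k) l (q i) <= 0 /\ edge_line q (cell k) l (q j) <= 0.
Proof.
move=> kt ij jn fij.
have first_in : 0%N \in cell k by rewrite mem_cell.
have last_in : (k.+1 * d).+1 \in cell k by rewrite mem_cell; lia.
have last_lt := cell_lt kt last_in.
have [j_low|j_high] := leqP j (k * d).+1.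
  exists 0%N => //; rewrite /edge_line next_cell //=.
  by rewrite !orient0_le //; lia.
have nextl : next (cell k) (k.+1 * d).+1 = 0%N by rewrite next_cell // ltnn.
have [j_high'|j_low] := leqP j (k.+1 * d).+1; last first.
  exists (k.+1 * d).+1 => //; rewrite /edge_line nextl.
  rewrite !(orient_swap (q 0%N)) !oppr_le0.
  split; last by apply: orient0_ge; rewrite // ltnW.
  have [->|i0] := eqVneq i 0%N; first by rewrite orient_l.
  have [ji|/eqP] := fan_lt ij fij; last by rewrite (negbTE i0).
  by apply: orient0_ge; lia.
have [i0|i0] := eqVneq i 0%N.
  exists (k.+1 * d).+1 => //; rewrite /edge_line nextl.
  suff -> : j = (k.+1 * d).+1 by rewrite i0 orient_l orient_r lexx.
  have : (j %% d)%N == 1%N by move: fij; rewrite /fan i0 /=; case: ((j %% d)%N == 1%N); lia.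
  move=> /eqP jd; have := divn_eq j d; rewrite jd => jE.
  have d_gt0 : (0 < d)%N by rewrite ltnW.
  have mk : (k < j %/ d)%N by rewrite -(ltn_pmul2r d_gt0); lia.
  have mk' : (j %/ d <= k.+1)%N by rewrite -(leq_pmul2r d_gt0); lia.
  by rewrite jE (_ : (j %/ d)%N = k.+1) ?addn1 //; lia.
have [ji|/eqP] := fan_lt ij fij; last by rewrite (negbTE i0).
exists i; first by rewrite mem_cell; lia.
rewrite /edge_line next_cell ?mem_cell ?(negbTE i0) ?ifT; try lia.
by rewrite ji orient_l orient_r.
Qed.

Lemma cell_avoids_fan k : (k <= t)%N -> open_polygon q (cell k) `<=` ~` fan_drawing.
Proof.
move=> kt x xo [i [j [i_lt j_lt fij]]].
wlog ij : i j i_lt j_lt fij / (i < j)%N => [wlog_lt|].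
  case: (ltngtP i j) => [||ij]; first exact: wlog_lt.
    by rewrite segmentC; apply: wlog_lt => //; rewrite fan_sym.
  by rewrite ij fan_irr in fij.
move=> /segmentP[s s01 xE].
have [l lc [li lj]] := cell_beyond kt ij j_lt fij.
have := xo l lc; rewrite xE /edge_line orient_line; move: li lj; rewrite /edge_line.
by move: (orient _ _ _) (orient _ _ _) => u v; nra.
Qed.

(** The sign of [orient (q 0) (q (k d + 1)) x] changes between two consecutive
    chords; they bound the cell that contains [x]. *)
Lemma cell_cover x : closed_polygon q hull_polygon x -> ~ fan_drawing x ->
  exists2 k, (k <= t)%N & open_polygon q (cell k) x.
Proof.
move=> xc xD.
have hull_in i : (i < n)%N -> i \in hull_polygon by rewrite mem_iota.
have x_first := xc 0%N (hull_in 0%N ltac:(lia)).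
have x_last := xc n.-1 (hull_in n.-1 ltac:(lia)).
rewrite /edge_line next_hull in x_first; last by lia.
rewrite ifT in x_first; last by lia.
rewrite /edge_line next_hull in x_last; last by lia.
rewrite ifF in x_last; last by lia.
pose f k := orient (q 0%N) (q (k * d).+1) x.
have [||k kn [fk fk1]] := @sign_change R f t.+1 _ x_first; first by [].
  have n1 : (t.+1 * d).+1 = n.-1 by lia.
  by rewrite /f n1 orient_swap oppr_le0.
exists k => //; apply: closed_not_boundary; first exact: cell_polygon.
  move=> i ic; rewrite /edge_line next_cell //; case: eqVneq => [->//|i0].
  have i_lt := cell_lt kn ic.
  case: leqP => ik.
    have := xc i (hull_in i i_lt); rewrite /edge_line next_hull // ifT // nE.
    have : (k.+1 * d <= t.+1 * d)%N by rewrite leq_mul2r kn orbT.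
    by lia.
  have -> : i = (k.+1 * d).+1 by move: ic; rewrite mem_cell (negbTE i0) /=; lia.
  by rewrite orient_swap oppr_ge0.
by move=> /(cell_boundary kn).
Qed.

Lemma fan_face x : ~ fan_drawing x -> conv_hull S x ->
  exists2 k, (k <= t)%N &
    frontier (connected_component (~` fan_drawing) x) = boundary q (cell k).
Proof.
move=> xD; rewrite hull_polygonE => /cell_cover/(_ xD)[k kt xo]; exists k => //.
have kc := cell_polygon kt.
rewrite (component_open_polygon kc xo); first exact: frontier_open_polygon xo.
  exact: cell_avoids_fan.
exact: cell_boundary.
Qed.
End Fan.
End ConvexChain.

Section Chords.
Context {R : realType} (q : nat -> R * R) (n : nat).
Hypothesis q_ccw : ccw q n.

(** If [c] and [d] lie weakly on the same side of the line [a b], then the segment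
    from [c] to [d] can touch this line only at an end lying on it. *)
Lemma one_sided_meet (a b c d x : R * R) :
  0 <= orient a b c * orient a b d -> segment a b x -> segment c d x ->
  [\/ orient a b c = 0 /\ orient a b d = 0, orient a b c = 0 /\ x = c
    | orient a b d = 0 /\ x = d].
Proof.
move=> cd0 /segmentP[r _ xab] /segmentP[s s01 xcd].
have : orient a b x = 0 by rewrite xab orient_line orient_l orient_r !mulr0 addr0.
rewrite {1}xcd orient_line => s0.
have [c0|c_neq0] := eqVneq (orient a b c) 0.
  have [d0|d_neq0] := eqVneq (orient a b d) 0; first by constructor 1.
  move: s0; rewrite c0 mulr0 add0r => /eqP; rewrite mulf_eq0 (negbTE d_neq0) orbF.
  by move=> /eqP s0; constructor 2; rewrite xcd s0 line0.
have [d0|d_neq0] := eqVneq (orient a b d) 0.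
  move: s0; rewrite d0 mulr0 addr0 => /eqP; rewrite mulf_eq0 (negbTE c_neq0) orbF.
  by rewrite subr_eq0 => /eqP s1; constructor 3; rewrite xcd -s1 line1.
have cd_gt0 : 0 < orient a b c * orient a b d.
  by rewrite lt_neqAle cd0 eq_sym mulf_neq0.
exfalso; move: s0 cd_gt0 c_neq0; move: (orient a b c) (orient a b d) => u v.
move=> s0 uv u0; have u2 : 0 < u * u by rewrite lt_neqAle eq_sym mulf_neq0 // -expr2 sqr_ge0.
have : u * ((1 - s) * u + s * v) = 0 by rewrite s0 mulr0.
have [-> | sn] := eqVneq s 0; first by lra.
by have : 0 < s by [rewrite lt_neqAle eq_sym sn; lra]; nra.
Qed.

Lemma orient_chord i j m : (i < j)%N -> (j < n)%N -> (m < n)%N ->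
  [/\ (i < m < j)%N -> orient (q i) (q j) (q m) < 0,
      (m < i)%N || (j < m)%N -> 0 < orient (q i) (q j) (q m) &
      orient (q i) (q j) (q m) = 0 -> m = i \/ m = j].
Proof.
move=> ij jn mn.
have between : (i < m < j)%N -> orient (q i) (q j) (q m) < 0.
  by move=> /andP[im mj]; rewrite orient_flip oppr_lt0 q_ccw.
have beyond : (m < i)%N || (j < m)%N -> 0 < orient (q i) (q j) (q m).
  by case/orP=> [mi|jm]; [rewrite -orient_cycle|]; apply: q_ccw.
split=> // m0; case: (ltngtP m i) => mi; [|case: (ltngtP m j) => mj; auto|by left].
  by have := beyond; rewrite mi m0 ltxx => /(_ isT).
  by have := between; rewrite mi mj m0 ltxx => /(_ isT).
by have := beyond; rewrite mj m0 ltxx orbT => /(_ isT).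
Qed.

(** If the ends do not interlace, then [k] and [l] lie on the same closed arc cut
    off by [i] and [j]. *)
Lemma chords_meet i j k l x :
  (i < j)%N -> (j < n)%N -> (k < l)%N -> (l < n)%N ->
  ~~ [&& i < k, k < j & j < l]%N -> ~~ [&& k < i, i < l & l < j]%N -> (i, j) <> (k, l) ->
  segment (q i) (q j) x -> segment (q k) (q l) x ->
  exists2 m, ((m == i) || (m == j)) && ((m == k) || (m == l)) & x = q m.
Proof.
move=> ij jn kl ln ikjl kilj ijkl xij xkl; have kn := ltn_trans kl ln.
have [k_in k_out k_eq] := orient_chord ij jn kn.
have [l_in l_out l_eq] := orient_chord ij jn ln.
have side : 0 <= orient (q i) (q j) (q k) * orient (q i) (q j) (q l).
  have [kij|kij] := boolP ((k == i) || (k == j)).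
    by case/orP: kij => /eqP->; rewrite ?orient_l ?orient_r mul0r.
  have [lij|lij] := boolP ((l == i) || (l == j)).
    by case/orP: lij => /eqP->; rewrite ?orient_l ?orient_r mulr0.
  have [ik|ik] := boolP (i < k < j)%N.
    by rewrite mulr_le0 // ltW ?k_in ?l_in //; lia.
  by rewrite mulr_ge0 // ltW ?k_out ?l_out //; lia.
case: (one_sided_meet side xij xkl) => [[/k_eq ek /l_eq el]|[/k_eq ek ->]|[/l_eq el ->]].
- by exfalso; apply: ijkl; congr pair; lia.
- by exists k => //; rewrite eqxx; lia.
- by exists l => //; rewrite eqxx; lia.
Qed.

Lemma fan_meet d i j k l x :
  (i < n)%N -> (j < n)%N -> (k < n)%N -> (l < n)%N -> fan d i j -> fan d k l ->
  ~ (i = k /\ j = l \/ i = l /\ j = k) ->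
  segment (q i) (q j) x -> segment (q k) (q l) x ->
  exists2 m, ((m == i) || (m == j)) && ((m == k) || (m == l)) & x = q m.
Proof.
move=> i_lt j_lt k_lt l_lt fij fkl.
wlog ij : i j i_lt j_lt fij / (i < j)%N => [wlog_lt|].
  case: (ltngtP i j) => [||ij]; first exact: wlog_lt.
    move=> ji ijkl xij xkl; move: xij; rewrite segmentC => xji.
    rewrite fan_sym in fij; have [|m mP xE] := wlog_lt j i j_lt i_lt fij ji _ xji xkl.
      by move=> h; apply: ijkl; lia.
    by exists m => //; rewrite [(m == i) || _]orbC.
  by rewrite ij fan_irr in fij.
wlog kl : k l k_lt l_lt fkl / (k < l)%N => [wlog_lt|].
  case: (ltngtP k l) => [||kl]; first exact: wlog_lt.
    move=> lk ijkl xij xkl; move: xkl; rewrite segmentC => xlk.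
    rewrite fan_sym in fkl; have [|m mP xE] := wlog_lt l k l_lt k_lt fkl lk _ xij xlk.
      by move=> h; apply: ijkl; lia.
    by exists m => //; rewrite [(m == k) || _]orbC.
  by rewrite kl fan_irr in fkl.
have := fan_lt ij fij; have := fan_lt kl fkl.
move=> kl1 ij1 ijkl; apply: chords_meet => //; [lia|lia|].
by case=> ik jl; apply: ijkl; left.
Qed.
End Chords.

(** * The cyclic order of points in convex position *)

Section CyclicOrder.
Context {R : realType} (n : nat) (p : 'I_n -> R * R).
Hypothesis p_convex : convex_position p.

Let others j := [set p k | k in [set k | k != j]].

Lemma convex_position_segment i j k : i != j -> k != j ->
  ~ segment (p i) (p k) (p j).
Proof.
move=> ij kj pj; apply: (p_convex (i := j)).
by apply: conv_hull_segment_closed pj; apply: sub_gen_smallest; [exists i|exists k].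
Qed.

Lemma convex_position_inj : injective p.
Proof.
move=> i j pij; apply: contrapT => /eqP ij.
by apply: (convex_position_segment ij ij); rewrite -pij; exact: segment_l.
Qed.

Lemma convex_position_triangle i j k l : i != l -> j != l -> k != l ->
  0 < orient (p i) (p j) (p k) -> 0 <= orient (p i) (p j) (p l) ->
  0 <= orient (p j) (p k) (p l) -> 0 <= orient (p k) (p i) (p l) -> False.
Proof.
move=> il jl kl ijk ijl jkl kil; apply: (p_convex (i := l)).
by apply: triangle_sub ijk ijl jkl kil;
  [exact: conv_hull_segment_closed|..]; apply: sub_gen_smallest;
  [exists i|exists j|exists k].
Qed.

Definition right_of (a b : R * R) := a.1 < b.1 \/ a.1 = b.1 /\ a.2 < b.2.

(** The lexicographic minimum. *)
Lemma leftmost : (0 < n)%N -> exists i0, forall j, j != i0 -> right_of (p i0) (p j).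
Proof.
move=> n_gt0; pose i1 := [arg min_(i < Ordinal n_gt0) (p i).1]%O.
have i1P j : (p i1).1 <= (p j).1.
  by rewrite /i1; case: Order.TotalTheory.arg_minP => // i _; apply.
pose i0 := [arg min_(i < i1 | (p i).1 == (p i1).1) (p i).2]%O.
have [i01 i0P] : (p i0).1 = (p i1).1 /\
    forall j, (p j).1 = (p i1).1 -> (p i0).2 <= (p j).2.
  rewrite /i0; case: Order.TotalTheory.arg_minP => // i /eqP i1E iP; split=> // j jE.
  by apply: iP; rewrite jE.
exists i0 => j ji0; have [lt|ge] := ltP (p i0).1 (p j).1; first by left.
have e1 : (p j).1 = (p i1).1 by apply/eqP; rewrite eq_le i1P -i01 ge.
right; split; first by rewrite e1.
rewrite lt_neqAle i0P // andbT; apply: contra_neq ji0 => e2.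
apply: convex_position_inj; rewrite [p j]surjective_pairing [p i0]surjective_pairing.
by rewrite e1 i01 e2.
Qed.

(** On a half-plane at [z] the sign of the orientation compares angles.  The half
    plane contains only one of the two vertical rays, so a point on the vertical
    through [z] is treated apart. *)
Lemma orient_right_trans (z a b c : R * R) :
  right_of z a -> right_of z b -> right_of z c ->
  0 <= orient z a b -> 0 <= orient z b c -> 0 <= orient z a c.
Proof.
move: z a b c => [z1 z2] [a1 a2] [b1 b2] [c1 c2]; rewrite /right_of /orient /=.
pose A1 := a1 - z1; pose A2 := a2 - z2; pose B1 := b1 - z1.
pose B2 := b2 - z2; pose C1 := c1 - z1; pose C2 := c2 - z2.
rewrite -/A1 -/A2 -/B1 -/B2 -/C1 -/C2 => oa ob oc ab bc.
have {}oa : 0 < A1 \/ A1 = 0 /\ 0 < A2 by rewrite /A1 /A2; case: oa; [left|right]; lra.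
have {}ob : 0 < B1 \/ B1 = 0 /\ 0 < B2 by rewrite /B1 /B2; case: ob; [left|right]; lra.
have {}oc : 0 < C1 \/ C1 = 0 /\ 0 < C2 by rewrite /C1 /C2; case: oc; [left|right]; lra.
move: A1 A2 B1 B2 C1 C2 ab bc oa ob oc => A1 A2 B1 B2 C1 C2 ab bc oa ob oc.
have A_ge0 : 0 <= A1 by case: oa => [|[]]; lra.
have C_ge0 : 0 <= C1 by case: oc => [|[]]; lra.
(* The cross products of three plane vectors satisfy a linear relation. *)
have key : B1 * (A1 * C2 - A2 * C1) = C1 * (A1 * B2 - A2 * B1) + A1 * (B1 * C2 - B2 * C1).
  by ring.
case: ob => [B1_gt0|[B1_0 B2_gt0]].
  by rewrite -(pmulr_rge0 _ B1_gt0) key addr_ge0 // mulr_ge0.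
have C1_0 : C1 = 0.
  move: bc; rewrite B1_0 mul0r sub0r oppr_ge0 (pmulr_rle0 _ B2_gt0) => C1_le0.
  by apply/eqP; rewrite eq_le C1_le0.
rewrite C1_0 mulr0 subr0 mulr_ge0 //.
by case: oc; last (by case=> _ /ltW); rewrite C1_0 ltxx.
Qed.

(** Collinear points of the half-plane are on the same ray from the pivot, and the
    nearer one would lie on the segment from the pivot to the other. *)
Lemma orient_right_neq0 i0 j k : (forall j, j != i0 -> right_of (p i0) (p j)) ->
  j != i0 -> k != i0 -> j != k -> orient (p i0) (p j) (p k) != 0.
Proof.
move=> i0P ji0 ki0 jk; apply/eqP => ijk.
have neq : p i0 != p j by apply: contra_neq ji0 => /convex_position_inj.
have [s kE] := collinear_line neq ijk.
have s_gt0 : 0 < s.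
  have := i0P j ji0; have := i0P k ki0; rewrite kE /right_of !lineE.
  move: (p i0).1 (p i0).2 (p j).1 (p j).2 => a1 a2 b1 b2.
  move=> hk hj; rewrite ltNge le_eqVlt; apply/negP => /orP[/eqP s0|s_lt0].
    by case: hk => [|[]]; rewrite s0; lra.
  by case: hk hj => [h1|[h1 h2]] [h3|[h3 h4]]; nra.
have [s1|s1] := leP s 1.
  apply: (@convex_position_segment i0 k j); rewrite // 1?eq_sym //.
  by apply/segmentP; exists s => //; rewrite ltW.
apply: (@convex_position_segment i0 j k); rewrite // 1?eq_sym //.
apply/segmentP; exists s^-1.
  by rewrite invr_ge0 ltW //= invf_le1 // ltW.
have s_neq0 : s != 0 by rewrite gt_eqF.
rewrite kE [p j]surjective_pairing [RHS]surjective_pairing !lineE.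
by congr pair; field.
Qed.

(** Sort by angle around the pivot.  A triple that avoids the pivot is also
    counterclockwise, because otherwise its middle point would lie in the
    triangle spanned by the pivot and the two other points. *)
Lemma ccw_order : (0 < n)%N -> exists s : seq 'I_n,
  [/\ uniq s, size s = n & forall i0, ccw (p \o nth i0 s) n].
Proof.
move=> n_gt0; have [i0 i0P] := leftmost n_gt0.
pose r : rel 'I_n := fun j k => 0 <= orient (p i0) (p j) (p k).
pose l := [seq j <- enum 'I_n | j != i0].
pose s := i0 :: sort r l.
have l_uniq : uniq l by rewrite filter_uniq // enum_uniq.
have s_uniq : uniq s by rewrite /= mem_sort mem_filter eqxx sort_uniq.
have s_all j : j \in s.
  by rewrite inE mem_sort mem_filter mem_enum; case: eqVneq.
have s_size : size s = n.
  rewrite -[RHS]card_ord -(card_uniqP s_uniq); apply: eq_card => j.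
  by rewrite s_all.
exists s; split=> // d0.
have r_total : total r.
  by move=> j k; rewrite /r [orient _ (p k) _]orient_flip oppr_ge0 le_total.
have r_trans : {in (fun j => j != i0) & &, transitive r}.
  by move=> k j m k0 j0 m0; apply: orient_right_trans; exact: i0P.
have l_neq : all (fun j => j != i0) (sort r l).
  by apply/allP => j; rewrite mem_sort mem_filter => /andP[].
have := sort_sorted r_total l; rewrite (sorted_pairwise_in r_trans l_neq).
move=> /(pairwiseP d0) r_lt.
have sub_size k : (k.+1 < n)%N -> (k < size (sort r l))%N.
  by move: (s_size) => /= sz kn; rewrite -ltnS sz.
have neq0 k : (k.+1 < n)%N -> nth d0 s k.+1 != i0.
  by move=> kn; apply: (allP l_neq); rewrite /= mem_nth // sub_size.
have nth_neq j k : (j < n)%N -> (k < n)%N -> j != k -> nth d0 s j != nth d0 s k.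
  by move=> jn kn jk; rewrite nth_uniq // s_size.
have pos j k : (j < k)%N -> (k.+1 < n)%N ->
    0 < orient (p i0) (p (nth d0 s j.+1)) (p (nth d0 s k.+1)).
  move=> jk kn; rewrite lt_neqAle eq_sym orient_right_neq0 ?neq0 ?nth_neq //=; try lia.
  by apply: r_lt => //; apply: sub_size; lia.
move=> [|i] [|j] [|k] //= ij jk kn; first exact: pos.
rewrite ltNge; apply/negP => ijk.
apply: (@convex_position_triangle i0 (nth d0 s i.+1) (nth d0 s k.+1) (nth d0 s j.+1)).
- by rewrite eq_sym neq0 //; lia.
- by apply: nth_neq; lia.
- by apply: nth_neq; lia.
- by apply: pos; lia.
- by apply/ltW/pos; lia.
- by rewrite orient_flip oppr_ge0.
- by rewrite orient_cycle; apply/ltW/pos; lia.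
Qed.
End CyclicOrder.

(** * Fan angulations of labelled points *)

(** The neighbours of [a] have positions 2 and [(t + 1) d]; neither is congruent
    to 1 modulo [d]. *)
Lemma hub_order_avoids_fan (V : eqType) (e : rel V) (a : V) (l : seq V) (d t : nat) :
  symmetric e -> (1 < d)%N -> (4 <= size l)%N -> size l = (t.+1 * d).+1 ->
  hub_order e a l -> forall i j, (i <= size l)%N -> (j <= size l)%N -> fan d i j ->
  ~~ e (nth a (a :: l) i) (nth a (a :: l) j).
Proof.
move=> e_sym d_ge2 l_ge4 l_size /andP[l_sorted /allP spoke].
have spoke_apart j : (j < size l)%N -> ~~ e a (nth a l j) || ((j == 1%N) || (j == size l - 2)%N).
  by move=> jl; rewrite -implybE; apply: spoke; rewrite mem_iota.
have step i : (i.+1 <= size l)%N -> ~~ e (nth a (a :: l) i) (nth a (a :: l) i.+1).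
  case: i => [|i] il /=.
    by have := spoke_apart 0%N il; case: (e _ _) => //=; lia.
  by move/(sortedP a): l_sorted; apply.
have jump j : (j <= size l)%N -> (j %% d)%N == 1%N -> ~~ e a (nth a (a :: l) j).
  case: j => [|j] jl; first by rewrite mod0n.
  move=> jd; have := spoke_apart j jl; case: (e _ _) => //= /orP[]/eqP j_eq; move: jd.
    rewrite j_eq; have [->|d_ge3] := eqVneq d 2%N; first by rewrite modnn.
    by rewrite modn_small //; lia.
  have -> : j.+1 = (t.+1 * d)%N by lia.
  by rewrite modnMl.
move=> i j il jl /or4P[/eqP ji|/eqP ij|/andP[/eqP-> jd]|/andP[/eqP-> id]].
- by rewrite ji in jl *; exact: step.
- by rewrite ij in il *; rewrite e_sym; exact: step.
- exact: jump.
- by rewrite e_sym; exact: jump.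
Qed.

Lemma mem_uniq_full (T : finType) (s : seq T) :
  uniq s -> size s = #|T| -> forall x, x \in s.
Proof.
move=> s_uniq s_size x.
have [||_ ->] := @uniq_min_size _ s (enum T) s_uniq _ _; rewrite ?mem_enum //.
  by move=> y _; rewrite mem_enum.
by rewrite -cardE s_size.
Qed.

Section Labels.
Context {R : realType} (n : nat) (p : 'I_n -> R * R) (s : seq 'I_n) (i0 : 'I_n).
Hypotheses (s_uniq : uniq s) (s_size : size s = n).
Hypothesis s_ccw : ccw (p \o nth i0 s) n.

Let q := p \o nth i0 s.
Let pos (u : 'I_n) : nat := index u s.

Let s_all u : u \in s.
Proof. by apply: mem_uniq_full => //; rewrite s_size card_ord. Qed.

Let pos_lt u : (pos u < n)%N. Proof. by rewrite -s_size index_mem s_all. Qed.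
Let posK u : nth i0 s (pos u) = u. Proof. exact: nth_index. Qed.
Let nthK k : (k < n)%N -> pos (nth i0 s k) = k.
Proof. by move=> kn; rewrite /pos index_uniq // s_size. Qed.
Let q_pos u : q (pos u) = p u. Proof. by rewrite /q /= posK. Qed.
Let pos_inj : injective pos. Proof. exact: can_inj posK. Qed.

Lemma range_nth : [set q i | i in [set i | (i < n)%N]] = range p.
Proof.
apply/seteqP; split=> [_ [i _ <-]|_ [u _ <-]]; first by exists (nth i0 s i).
by exists (pos u); [exact: pos_lt|exact: q_pos].
Qed.

Definition fan_graph d : rel 'I_n := fun u v => fan d (pos u) (pos v).

Lemma drawing_fan_graph d : drawing p (fan_graph d) = fan_drawing q n d.
Proof.
apply/seteqP; split=> [x [u [v [uv xuv]]]|x [i [j [i_lt j_lt ij xij]]]].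
  by exists (pos u), (pos v); split; rewrite ?q_pos.
exists (nth i0 s i), (nth i0 s j); split=> //.
by rewrite /fan_graph !nthK.
Qed.

Lemma fan_angulation g t : (4 <= g)%N -> n = (t.+1 * (g - 2) + 2)%N ->
  g_angulation p g (fan_graph (g - 2)).
Proof.
move=> g_ge4 nE; set d := (g - 2)%N in nE *.
have d_ge2 : (2 <= d)%N by rewrite /d; lia.
have n_gt2 : (2 < n)%N by nia.
split.
- split; first by move=> u v; exact: fan_sym.
  by move=> u; exact: fan_irr.
- move=> i j k l ij kl ijkl x; rewrite -!q_pos => xij xkl.
  have [|m /andP[mij mkl] xE] :=
    fan_meet s_ccw (pos_lt i) (pos_lt j) (pos_lt k) (pos_lt l) ij kl _ xij xkl.
    case=> [] [/pos_inj e1 /pos_inj e2]; move/eqP: ijkl; apply.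
      by rewrite e1 e2.
    by rewrite e1 e2 finset.setUC.
  exists (nth i0 s m); last by [].
  have label u : (m == pos u) -> nth i0 s m == u by move=> /eqP->; rewrite posK.
  by rewrite !inE; apply/andP; split; [case/orP: mij|case/orP: mkl] => /label ->;
    rewrite ?orbT.
- (* The last position is [(t + 1) d + 1], congruent to 1 modulo [d]. *)
have wrap i : next (hull_polygon n) (pos i) = (pos i).+1 \/
      next (hull_polygon n) (pos i) = 0%N /\ (pos i %% d)%N = 1%N.
    rewrite next_hull //; case: ltnP => i_last; [by left|right; split=> //].
    have -> : pos i = (t.+1 * d + 1)%N by have := pos_lt i; lia.
    by rewrite modnMDl modn_small.
  move=> i j ij; rewrite -!q_pos -range_nth => ij_hull.
  have pij : pos i != pos j by apply: contra_neq ij => /pos_inj.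
  have := hull_frontier_edge s_ccw n_gt2 (pos_lt i) (pos_lt j) pij ij_hull.
  rewrite /fan_graph; case=> E.
    by have := wrap i; rewrite -E /fan => -[->|[-> ->]]; rewrite eqxx ?orbT.
  by have := wrap j; rewrite -E /fan => -[->|[-> ->]]; rewrite eqxx ?orbT.
move=> F [x xD ->] Fhull.
have Fx : connected_component (~` drawing p (fan_graph d)) x x.
  exact: connected_component_refl.
have := Fhull x Fx; rewrite -range_nth drawing_fan_graph in xD *.
case/(fan_face s_ccw n_gt2 d_ge2 nE xD) => k kt frontE.
have cell_ltn i : i \in cell d k -> (i < n)%N by exact: cell_lt nE _ _ kt.
pose c := map (nth i0 s) (cell d k).
have c_pos : map pos c = cell d k.
  rewrite -map_comp; apply: map_id_in => i ic.
  by rewrite /= nthK // cell_ltn.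
have cell_uniq : uniq (cell d k) by case: (cell_polygon s_ccw n_gt2 d_ge2 nE kt).
have c_uniq : uniq c by rewrite -(map_inj_uniq pos_inj) c_pos.
have c_next u : pos (next c u) = next (cell d k) (pos u).
  by rewrite -c_pos next_map.
have in_c u : (u \in c) = (pos u \in cell d k) by rewrite -c_pos mem_map.
exists c; split=> //.
- by rewrite size_map /= size_iota /d; lia.
- apply: (sub_in_cycle (P := mem c)) (cycle_next c_uniq); last exact/allP.
  move=> u v uc _ /eqP <-; rewrite /fan_graph c_next.
  by apply: (cell_fan d_ge2); rewrite -in_c; exact: uc.
rewrite frontE; apply/seteqP; split=> [y [i ic yi]|y [u uc yu]].
  exists (nth i0 s i); first by rewrite in_c nthK ?cell_ltn.
  have -> : p (next c (nth i0 s i)) = q (next (cell d k) i).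
    by rewrite -q_pos c_next nthK ?cell_ltn.
  by [].
exists (pos u); first by rewrite -in_c.
by move: yu; rewrite -!q_pos c_next.
Qed.

Lemma hull_graph_edge T g i : (2 < n)%N -> g_angulation p g T -> (i < n)%N ->
  T (nth i0 s i) (nth i0 s (next (hull_polygon n) i)).
Proof.
move=> n_gt2 [_ _ hullT _] i_lt.
have [h_uniq h_ge3 _] := hull_polygon_convex s_ccw n_gt2.
have ih : i \in hull_polygon n by rewrite mem_iota.
have [ni _ _] := next_neq h_uniq h_ge3 ih.
have next_lt : (next (hull_polygon n) i < n)%N.
  have : next (hull_polygon n) i \in hull_polygon n by rewrite mem_next.
  by rewrite mem_iota.
apply: hullT; first by rewrite nth_uniq ?s_size // eq_sym.
rewrite -range_nth; exact: (hull_edge_frontier s_ccw n_gt2 i_lt).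
Qed.
End Labels.

Theorem theorem6 (R : realType) (g t n : nat)
  (g_ge4 : (4 <= g)%N) (n_def : n = (g + t * (g - 2))%N)
  (p : 'I_n -> (R * R)%type) (p_convex : convex_position p)
  (V : finType) (F : rel V)
  (F_simple : simple_graph F) (F_order : #|V| = n)
  (F_regular : regular_graph 2 F) :
  potentially_g_angulable p g F <-> (5 <= n)%N.
Proof.
have n_ge4 : (4 <= n)%N by lia.
have n_gt0 : (0 < n)%N by lia.
have nE : n = (t.+1 * (g - 2) + 2)%N by rewrite mulSn; lia.
have [F_sym F_irr] := F_simple.
have [s [s_uniq s_size s_ccw]] := ccw_order p_convex n_gt0.
pose i0 := Ordinal n_gt0.
split=> [[f f_bij [T T_ang T_avoids]]|n_ge5].
  rewrite ltnNge; apply/negP => n_le4.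
  have n4 : n = 4%N by lia.
  have n_gt2 : (2 < n)%N by lia.
  have edge i := hull_graph_edge s_uniq s_size (s_ccw i0) (i := i) n_gt2 T_ang.
  have [T_sym T_irr] : simple_graph T by case: T_ang.
  have e01 : T (nth i0 s 0) (nth i0 s 1).
    by have := edge 0%N; rewrite next_hull // ifT; [apply; lia|lia].
  have e03 : T (nth i0 s 0) (nth i0 s 3).
    rewrite T_sym; have := edge 3%N; rewrite next_hull; last by lia.
    by rewrite ifF; [apply; lia|lia].
  have [f' fK f'K] := f_bij.
  have [x [y [yx nb]]] := two_neighbours F_regular (f' (nth i0 s 0)).
  have missed v u : F (f' (nth i0 s 0)) v -> T (nth i0 s 0) u -> f v != u.
    move=> Fv /T_avoids /andP[_]; apply: contraNneq => <-.
    by apply/existsP; exists (f' (nth i0 s 0)); apply/existsP; exists v;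
      rewrite Fv f'K !eqxx.
  have moved v : F (f' (nth i0 s 0)) v -> f v != nth i0 s 0.
    by move=> Fv; apply: contraTneq Fv => <-; rewrite fK F_irr.
  have Fx : F (f' (nth i0 s 0)) x by rewrite nb eqxx.
  have Fy : F (f' (nth i0 s 0)) y by rewrite nb eqxx orbT.
  (* The point 0 is joined to the points 1 and 3, and its vertex to [x] and [y]: five
     different points. *)
  pose five := [:: f x; f y; nth i0 s 0; nth i0 s 1; nth i0 s 3].
  have /card_uniqP five_card : uniq five.
    rewrite /= !inE !negb_or (bij_eq f_bij) eq_sym yx !moved ?missed //.
    by rewrite !nth_uniq ?s_size ?n4.
  by have := max_card (mem five); rewrite five_card card_ord leqNgt ltnS n_le4.
have [a [l [al_uniq al_size al_hub]]] : exists a l,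
    [/\ uniq (a :: l), size (a :: l) = #|V| & hub_order F a l].
  by apply: hub_order_exists => //; rewrite F_order.
have al_all v : v \in a :: l by exact: mem_uniq_full.
pose rank v := index v (a :: l).
have rank_le v : (rank v <= size l)%N by rewrite -ltnS -[(size l).+1]/(size (a :: l)) index_mem.
have l_size : (size l).+1 = n by rewrite -F_order -al_size.
have rank_lt v : (rank v < size s)%N by rewrite s_size -l_size ltnS.
pose f v := nth i0 s (rank v).
have f_bij : bijective f.
  apply: inj_card_bij; last by rewrite card_ord F_order.
  move=> u v /eqP; rewrite nth_uniq // => /eqP uv.
  by rewrite -[u](nth_index a (al_all u)) -[v](nth_index a (al_all v)) -/(rank u) uv.
exists f => //; exists (fan_graph s (g - 2)).
  exact: (fan_angulation s_uniq s_size (s_ccw i0) g_ge4 nE).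
move=> u v uv; apply/andP; split.
  by apply: contraTneq uv => ->; rewrite /fan_graph fan_irr.
apply/existsP => -[x /existsP[y /and3P[Fxy /eqP fx /eqP fy]]].
have : fan (g - 2) (rank x) (rank y).
  by move: uv; rewrite /fan_graph -fx -fy !index_uniq.
have d_ge2 : (1 < g - 2)%N by lia.
have l_ge4 : (4 <= size l)%N by lia.
have l_sizeE : size l = (t.+1 * (g - 2)).+1 by lia.
have := hub_order_avoids_fan F_sym d_ge2 l_ge4 l_sizeE al_hub (rank_le x) (rank_le y).
by move=> /[apply]; rewrite /rank !nth_index // Fxy.
Qed.
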